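(* Let $X=(\Omega_1,\mathcal{F}_1,\mathbb{P}_1,\tau^{(1)})$ and $Y=(\Omega_2,\mathcal{F}_2,\mathbb{P}_2,\tau^{(2)})$ be metric dynamical systems of dimensions $d_1$ and $d_2$, and $(\Omega,\mathcal{F}):=(\Omega_1\times\Omega_2,\mathcal{F}_1\otimes\mathcal{F}_2)$. For any joining $\mathbb{P}\in J_e(X,Y)$, any potential $V$ on $\Omega$ (w.r.t. $\mathbb{P}$) and any $y\in\mathbb{R}^{d_1}$, $$\Gamma_V^{\mathbb{P},e}(\hat y)\le\Gamma^{\mathbb{P}_1}_{\mathbb{E}[V|\pi_1=\cdot]}(y),$$ where $\hat y:=(y_1,\dots,y_{d_1},0,\dots,0)\in\mathbb{R}^{d_1+d_2}$. If $d_1=d_2$, then for any joining $\mathbb{P}\in J_p(X,Y)$, any potential $V$ on $\Omega$ (w.r.t. $\mathbb{P}$) and any $y\in\mathbb{R}^{d_1}$, $$\Gamma_V^{\mathbb{P},p}(y)\le\Gamma^{\mathbb{P}_1}_{\mathbb{E}[V|\pi_1=\cdot]}(y).$$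
   Context: A metric dynamical system of dimension $d\in\mathbb{N}$ is $(\Omega,\mathcal{F},\mathbb{P},\tau)$ with $(\Omega,\mathcal{F},\mathbb{P})$ a probability space, $\tau:\mathbb{R}^d\times\Omega\to\Omega$, $(x,\omega)\mapsto\tau_x\omega$, a product measurable action of the group $(\mathbb{R}^d,+)$ on $\Omega$, and $\mathbb{P}$ invariant under $\tau_x$ for all $x\in\mathbb{R}^d$. $\mathbb{E}$ is expectation w.r.t. $\mathbb{P}$, $L^p=L^p(\Omega,\mathcal{F},\mathbb{P})$. A potential is a nonnegative $V\in L^1$. For measurable $f$ on $\Omega$ put $f_\omega(x):=f(\tau_x\omega)$. If $f_\omega$ is differentiable for all $\omega$, put $(Df)(\omega):=D(f_\omega)(0)$; $D^nf$, $\nabla f$ and $\nabla\cdot\phi$ are defined in the same way. For such a system, $\mathbb{F}$ is the set of $f\in L^1$ such that $\mathbb{E}f=1$, there is $c_f>0$ with $f\ge c_f$, $f_\omega$ is differentiable of any order for all $\omega$, and $\sup_\Omega|D^nf|<\infty$ for all $n\in\mathbb{N}_0$. For $y\in\mathbb{R}^d$, $\Phi_y$ is the set of $\phi\in(L^1)^d$ such that $\phi_\omega$ is differentiable of any order for all $\omega$, $\sup_\Omega|D^n\phi|<\infty$ for all $n\in\mathbb{N}_0$, $\mathbb{E}\phi=y$, and $\nabla\cdot\phi=0$ for all $\omega$. Define $$\Gamma_V(y):=2\inf_{f\in\mathbb{F}}\left[\left(\int\frac{|\nabla f|^2}{8f}+Vf\,d\mathbb{P}\right)\left(\inf_{\phi\in\Phi_y}\int\frac{|\phi|^2}{2f}\,d\mathbb{P}\right)\right]^{1/2}.$$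 Actions on $\Omega=\Omega_1\times\Omega_2$. Extension: for $x=(x_1,x_2)\in\mathbb{R}^{d_1}\times\mathbb{R}^{d_2}$, $\tau^e_x\omega:=(\tau^{(1)}_{x_1}\omega_1,\tau^{(2)}_{x_2}\omega_2)$. Perturbation (if $d_1=d_2$): for $x\in\mathbb{R}^{d_1}$, $\tau^p_x\omega:=(\tau^{(1)}_x\omega_1,\tau^{(2)}_x\omega_2)$. $J_e(X,Y)$ (resp. $J_p(X,Y)$), the set of joinings, is the set of probability measures $\mathbb{P}$ on $(\Omega,\mathcal{F})$ with marginals $\mathbb{P}_1$ and $\mathbb{P}_2$ that are invariant under $\tau^e$ (resp. $\tau^p$). $\Gamma^{\mathbb{P}_1}$, $\Gamma^{\mathbb{P},e}$, $\Gamma^{\mathbb{P},p}$ denote the functional $\Gamma$ for the systems $X$, $(\Omega,\mathcal{F},\mathbb{P},\tau^e)$ (dimension $d_1+d_2$) and $(\Omega,\mathcal{F},\mathbb{P},\tau^p)$ (dimension $d_1$) respectively. $\pi_1:\Omega_1\times\Omega_2\to\Omega_1$ is the projection, and $\mathbb{E}[V|\pi_1=\cdot]$ is the conditional expectation of $V$ given $\pi_1$ (under $\mathbb{P}$), viewed as a function on $\Omega_1$; $\Gamma^{\mathbb{P}_1}$ does not depend on the version chosen. *)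

(* Defs.v *)
From HB Require Import structures.
From mathcomp Require Import all_boot all_order all_algebra.
From mathcomp Require Import all_classical all_reals all_analysis.

Set Implicit Arguments.
Unset Strict Implicit.
Unset Printing Implicit Defensive.

Import Order.TTheory GRing.Theory Num.Theory.
Import numFieldNormedType.Exports.

Local Open Scope classical_set_scope.
Local Open Scope ring_scope.

(* R^d with its Borel sigma-algebra. *)
Definition borel_rV (R : realType) (d : nat) :=
  g_sigma_algebraType (@open 'rV[R]_d).

(* The squared Euclidean norm; the library norm on 'rV[R]_d is the sup norm. *)
Definition sqnorm (R : realType) (d : nat) (v : 'rV[R]_d) : R :=
  \sum_(i < d) v 0 i ^+ 2.

(* For s = [:: i_1; ...; i_n], the partial derivative
   d_(i_1) ... d_(i_n) F, i.e. the (i_1, ..., i_n) entry of D^n F. *)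
Definition partials (R : realType) (d : nat) (s : seq 'I_d)
    (F : 'rV[R]_d -> R) : 'rV[R]_d -> R :=
  foldr (fun i G x => 'D_('e_i) G x) F s.

(* "Differentiable of any order": D^n F is (Frechet) differentiable for every
   n, i.e. all its entries are. *)
Definition smooth (R : realType) (d : nat) (F : 'rV[R]_d -> R) : Prop :=
  forall (s : seq 'I_d) (x : 'rV[R]_d), differentiable (partials s F) x.

Section metric_dynamical_systems.
Context {R : realType} {d : nat} {disp : measure_display}
  {T : measurableType disp}.
Implicit Types (P : probability T R) (tau : 'rV[R]_d -> T -> T)
  (f V : T -> R) (phi : T -> 'rV[R]_d) (y : 'rV[R]_d).

Definition invariant P tau : Prop :=
  forall (x : 'rV[R]_d) (A : set T), measurable A -> P (tau x @^-1` A) = P A.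

Definition metric_dynamical_system P tau : Prop :=
  [/\ (0 < d)%N,
      forall w, tau 0 w = w,
      forall x1 x2 w, tau (x1 + x2) w = tau x1 (tau x2 w),
      measurable_fun setT (fun p : borel_rV R d * T => tau p.1 p.2) &
      invariant P tau].

Definition potential P V : Prop :=
  (forall w, 0 <= V w) /\ P.-integrable setT (EFin \o V).

Definition realization tau f (w : T) : 'rV[R]_d -> R := fun x => f (tau x w).

Definition Dpart tau (s : seq 'I_d) f (w : T) : R :=
  partials s (realization tau f w) 0.

(* The Euclidean norm of the tensor (D^n f)(w). *)
Definition normD tau (n : nat) f (w : T) : R :=
  Num.sqrt (\sum_(s : n.-tuple 'I_d) Dpart tau s f w ^+ 2).

Definition grad tau f (w : T) : 'rV[R]_d := \row_i Dpart tau [:: i] f w.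

Definition coordinate phi (i : 'I_d) : T -> R := fun w => phi w 0 i.

Definition normDvec tau (n : nat) phi (w : T) : R :=
  Num.sqrt (\sum_(i < d) \sum_(s : n.-tuple 'I_d)
              Dpart tau s (coordinate phi i) w ^+ 2).

Definition divergence tau phi (w : T) : R :=
  \sum_(i < d) Dpart tau [:: i] (coordinate phi i) w.

Definition class_F P tau : set (T -> R) := [set f |
  [/\ P.-integrable setT (EFin \o f),
      ('E_P[f] = 1)%E,
      exists c : R, 0 < c /\ forall w, c <= f w,
      forall w, smooth (realization tau f w) &
      forall n, exists M : R, forall w, normD tau n f w <= M]].

Definition class_Phi P tau y : set (T -> 'rV[R]_d) := [set phi |
  [/\ forall i, P.-integrable setT (EFin \o coordinate phi i),
      forall i w, smooth (realization tau (coordinate phi i) w),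
      forall n, exists M : R, forall w, normDvec tau n phi w <= M,
      forall i, ('E_P[coordinate phi i] = (y 0 i)%:E)%E &
      forall w, divergence tau phi w = 0]].

Definition Gamma P tau V y : \bar R :=
  (2%:E * ereal_inf [set sqrte
     ((\int[P]_w (sqnorm (grad tau f w) / (8 * f w) + V w * f w)%:E) *
      ereal_inf [set \int[P]_w (sqnorm (phi w) / (2 * f w))%:E
                | phi in class_Phi P tau y])
     | f in class_F P tau])%E.

End metric_dynamical_systems.

Section products.
Context {R : realType} {disp1 disp2 : measure_display}
  {T1 : measurableType disp1} {T2 : measurableType disp2}.

Definition extension (d1 d2 : nat) (tau1 : 'rV[R]_d1 -> T1 -> T1)
    (tau2 : 'rV[R]_d2 -> T2 -> T2) : 'rV[R]_(d1 + d2) -> T1 * T2 -> T1 * T2 :=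
  fun x w => (tau1 (lsubmx x) w.1, tau2 (rsubmx x) w.2).

Definition perturbation (d1 d2 : nat) (eqd : d1 = d2)
    (tau1 : 'rV[R]_d1 -> T1 -> T1) (tau2 : 'rV[R]_d2 -> T2 -> T2) :
    'rV[R]_d1 -> T1 * T2 -> T1 * T2 :=
  fun x w => (tau1 x w.1, tau2 (castmx (erefl 1%N, eqd) x) w.2).

Definition joining (d : nat) (P1 : probability T1 R) (P2 : probability T2 R)
    (tau : 'rV[R]_d -> T1 * T2 -> T1 * T2)
    (P : probability (T1 * T2)%type R) : Prop :=
  [/\ forall A : set T1, measurable A -> P (fst @^-1` A) = P1 A,
      forall B : set T2, measurable B -> P (snd @^-1` B) = P2 B &
      invariant P tau].

(* g is a version of w1 |-> E[V | pi_1 = w1] under P. *)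
Definition is_condexp_fst (P : probability (T1 * T2)%type R)
    (V : T1 * T2 -> R) (g : T1 -> R) : Prop :=
  [/\ measurable_fun setT g,
      P.-integrable setT (fun w => (g w.1)%:E) &
      forall A : set T1, measurable A ->
        (\int[P]_(w in fst @^-1` A) (g w.1)%:E =
         \int[P]_(w in fst @^-1` A) (V w)%:E)%E].

End products.

(* Main.v *)
Require Import Defs.
From HB Require Import structures.
From mathcomp Require Import all_boot all_order all_algebra.
From mathcomp Require Import all_classical all_reals all_analysis.
From mathcomp Require Import measurable_realfun.

Set Implicit Arguments.
Unset Strict Implicit.
Unset Printing Implicit Defensive.

Import Order.TTheory GRing.Theory Num.Theory.
Import numFieldNormedType.Exports.

Local Open Scope classical_set_scope.
Local Open Scope ring_scope.

(** Test functions f and phi for X pull back along the projection pi_1 : the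
orbit realizations of f \o pi_1 are those of f composed with a coordinate
projection L of R^d, so its derivatives are those of f, or zero in the directions
killed by L, and phi \o pi_1, padded with zeros, stays divergence free. Since P
projects to P_1, the energies involving f and phi are unchanged, and
E[V (f \o pi_1)] = E_1[E[V | pi_1] f] because f is bounded. Hence the infima
defining Gamma for the joining run over at least the values attained on X. *)

(** * Integration of functions that factor through [pi] *)

Section integration.
Context {R : realType} {disp disp1 : measure_display}
  {T : measurableType disp} {T1 : measurableType disp1}.
Implicit Types (mu : {measure set T -> \bar R}) (P : probability T R).

Import HBNNSimple.

Lemma integrable_bounded_mul mu (u f : T -> R) (M : R) :
  mu.-integrable setT (EFin \o u) -> measurable_fun setT f ->
  (forall w, `|f w| <= M) -> mu.-integrable setT (fun w => (u w * f w)%:E).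
Proof.
move=> iu mf fM.
have mu' : measurable_fun setT u by apply/measurable_EFinP; exact: measurable_int iu.
apply: (@le_integrable _ _ _ mu _ _ _ (fun w => M%:E * (u w)%:E)%E) => //.
- by apply/measurable_EFinP; exact: measurable_funM.
- move=> w _; rewrite -EFinM !abse_EFin lee_fin !normrM mulrC ler_wpM2r//.
  exact: le_trans (fM w) (ler_norm _).
- exact: integrableZl.
Qed.

Lemma integrable_bounded P (f : T -> R) (M : R) :
  measurable_fun setT f -> (forall w, `|f w| <= M) ->
  P.-integrable setT (EFin \o f).
Proof.
move=> mf fM; have := @integrable_bounded_mul P (cst 1) f M.
under [X in _ -> _ -> _ -> P.-integrable _ X]eq_fun do rewrite /= mul1r.
by apply => //; exact: finite_measure_integrable_cst.
Qed.

(* Both integrals are limits of the integrals against the simple functions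
   approximating f, by dominated convergence. *)
Lemma integral_mul_preim mu (pi : T -> T1) (u v : T -> R) (f : T1 -> R) (M : R) :
  measurable_fun setT pi ->
  mu.-integrable setT (EFin \o u) -> mu.-integrable setT (EFin \o v) ->
  (forall A, measurable A ->
    (\int[mu]_(w in pi @^-1` A) (u w)%:E = \int[mu]_(w in pi @^-1` A) (v w)%:E)%E) ->
  measurable_fun setT f -> (forall z, 0 <= f z <= M) ->
  (\int[mu]_w (u w * f (pi w))%:E = \int[mu]_w (v w * f (pi w))%:E)%E.
Proof.
move=> mpi iu iv uv mf f0M.
have fe0 (z : T1) : [set: T1] z -> (0 <= (EFin \o f) z)%E.
  by move=> _; rewrite lee_fin; case/andP: (f0M z).
have mfe : measurable_fun [set: T1] (EFin \o f) by exact/measurable_EFinP.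
pose h := nnsfun_approx measurableT mfe.
have mh n : measurable_fun setT (h n \o pi) by exact: measurableT_comp.
(* The approximants stay below [f], so they inherit its bound; [M] times [|k|] then dominates every
   [k * (h n \o pi)]. *)
have hM n z : `|h n z| <= M.
  have h0 : 0 <= h n z by [].
  rewrite ger0_norm// -lee_fin.
  have /andP[_] := f0M z; rewrite -lee_fin; apply: le_trans.
  rewrite /h nnsfun_approxE; exact: le_approx.
have lim (k : T -> R) : mu.-integrable setT (EFin \o k) ->
    (\int[mu]_w (k w * h n (pi w))%:E @[n --> \oo] -->
     \int[mu]_w (k w * f (pi w))%:E)%E.
  move=> ik.
  have mk : measurable_fun setT k by apply/measurable_EFinP; exact: measurable_int ik.
  have [] := @dominated_convergence _ _ _ mu setT measurableT
    (fun n w => (k w * h n (pi w))%:E) (fun w => (k w * f (pi w))%:E)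
    (fun w => M%:E * `|(k w)%:E|)%E; last by [].
  - by move=> n; apply/measurable_EFinP; exact: (measurable_funM mk (mh n)).
  - apply/measurable_EFinP; exact: (measurable_funM mk (measurableT_comp mf mpi)).
  - apply: aeW => w _; under eq_fun do rewrite EFinM; rewrite EFinM.
    apply: cvgeZl => //.
    exact: (cvg_nnsfun_approx measurableT mfe fe0 (I : setT (pi w))).
  - apply: integrableZl => //; exact: integrable_abse ik.
  - apply: aeW => w n _; rewrite abse_EFin normrM -EFinM lee_fin mulrC.
    by rewrite ler_wpM2r.
have indic (k : T -> R) (A : set T1) : measurable A ->
    (\int[mu]_w (k w * \1_A (pi w))%:E = \int[mu]_(w in pi @^-1` A) (k w)%:E)%E.
  move=> mA; rewrite [RHS]integral_mkcond; apply: eq_integral => w _.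
  rewrite patchE /= indicE.
  have -> : (w \in pi @^-1` A) = (pi w \in A) by [].
  by case: (pi w \in A); rewrite /= ?mulr1 ?mulr0.
(* With [e] listing the values of [h n], the function is a finite combination of indicators of its
   level sets; [uv] applies on each of these. *)
have simple (k : T -> R) n : mu.-integrable setT (EFin \o k) ->
    let e := finmap.enum_fset (fset_set (range (h n))) in
    (\int[mu]_w (k w * h n (pi w))%:E = \sum_(i < size e)
      (e`_i)%:E * \int[mu]_(w in pi @^-1` (h n @^-1` [set e`_i])) (k w)%:E)%E.
  move=> ik e.
  have mi i : measurable (h n @^-1` [set e`_i]) by [].
  have ii (i : 'I_(size e)) : mu.-integrable setT
      (fun w => (k w * \1_(h n @^-1` [set e`_i]) (pi w))%:E).
    apply: (integrable_bounded_mul (f := \1_(h n @^-1` [set e`_i]) \o pi) (M := 1)) => //.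
      by apply: measurableT_comp => //; exact: measurable_indic.
    by move=> w; rewrite /= indicE; case: (_ \in _); rewrite ?normr1 ?normr0.
  under eq_integral => w _.
    rewrite (fimfunEord (h n)) mulr_sumr -sumEFin.
    under eq_bigr do rewrite mulrCA EFinM.
    over.
  rewrite integral_sum//; last by move=> i; exact: integrableZl.
  by apply: eq_bigr => i _; rewrite integralZl// indic.
have uvh n : (\int[mu]_w (u w * h n (pi w))%:E = \int[mu]_w (v w * h n (pi w))%:E)%E.
  by rewrite !simple//; apply: eq_bigr => i _; rewrite uv.
rewrite -(cvg_lim (@ereal_hausdorff R) (lim u iu)).
rewrite -(cvg_lim (@ereal_hausdorff R) (lim v iv)).
by congr (limn _); apply/funext.
Qed.

(** The pushforward of [P] under [pi] agrees with [Q] on measurable sets, so [|f|] and [|f \o pi|]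
    have the same integral. *)
Lemma integrable_marginal P (Q : probability T1 R) (pi : T -> T1) (f : T1 -> R) :
  measurable_fun setT pi ->
  (forall A, measurable A -> P (pi @^-1` A) = Q A) ->
  Q.-integrable setT (EFin \o f) -> P.-integrable setT (EFin \o (f \o pi)).
Proof.
move=> mpi PQ /integrableP[mf]; move=> fin; apply/integrableP.
split; first exact: (measurableT_comp mf mpi).
apply: le_lt_trans fin; rewrite le_eqVlt; apply/orP; left; apply/eqP.
transitivity (\int[pushforward P pi]_z `|(f z)%:E|)%E; last first.
  by apply: eq_measure_integral => A mA _; exact: PQ.
by rewrite (ge0_integral_pushforward mpi)//; exact: measurableT_comp.
Qed.

(** Stated for signed integrable [f], because a version of the conditional expectation may take
    negative values. *)
Lemma integral_marginal P (Q : probability T1 R) (pi : T -> T1) (f : T1 -> R) :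
  measurable_fun setT pi ->
  (forall A, measurable A -> P (pi @^-1` A) = Q A) ->
  measurable_fun setT f -> P.-integrable setT (EFin \o (f \o pi)) ->
  (\int[P]_w (f (pi w))%:E = \int[Q]_z (f z)%:E)%E.
Proof.
move=> mpi PQ mf ifpi.
have -> : (\int[Q]_z (f z)%:E = \int[pushforward P pi]_z (f z)%:E)%E.
  by apply: eq_measure_integral => A mA _; rewrite /= /pushforward PQ.
by rewrite (integral_pushforward mpi)//; exact/measurable_EFinP.
Qed.

End integration.

(** * Integrability of the quadratic energy densities *)

Lemma sqnorm_ge0 (R : realType) (d : nat) (v : 'rV[R]_d) : 0 <= sqnorm v.
Proof. by apply: sumr_ge0 => i _; exact: sqr_ge0. Qed.

(** The numerator is bounded and the denominator is at least [k * c], so the quotient is bounded. It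
    serves the gradient term with [k = 8] and the field term with [k = 2]. *)
Lemma integrable_sqnorm_div (R : realType) (disp1 : measure_display)
    (T1 : measurableType disp1) (d : nat) (Q : probability T1 R)
    (v : T1 -> 'rV[R]_d) (f : T1 -> R) (k c : R) :
  (forall i, measurable_fun setT (coordinate v i)) ->
  (forall i, exists M, forall z, `|coordinate v i z| <= M) ->
  measurable_fun setT f -> 0 < k -> 0 < c -> (forall z, c <= f z) ->
  Q.-integrable setT (fun z => (sqnorm (v z) / (k * f z))%:E).
Proof.
move=> mv /choice[M vM] mf k0 c0 cf.
have f0 z : 0 < f z by exact: lt_le_trans (cf z).
apply: (@integrable_bounded _ _ _ Q (fun z => sqnorm (v z) / (k * f z)) ((\sum_i M i ^+ 2) / (k * c))).
  apply: measurable_funM.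
    by apply: measurable_sum => i; apply: measurable_funX; exact: mv.
  (* Measurability of the inverse is obtained from that of the real power with exponent -1. *)
  have -> : (fun z => (k * f z)^-1) = (fun z => (k * f z) `^ (-1)).
    by apply/funext => z; rewrite powR_inv1// mulr_ge0// ltW.
  by apply: (measurableT_comp (measurable_powR _)); exact: measurable_funM.
move=> z; have s0 := sqnorm_ge0 (v z).
have kf0 : 0 < k * f z by rewrite mulr_gt0.
rewrite ger0_norm ?divr_ge0 ?(ltW kf0)//.
apply: ler_pM => //; first by rewrite invr_ge0 ltW.
  apply: ler_sum => i _; rewrite -real_normK ?num_real// lerXn2r ?nnegrE//.
    exact: le_trans (vM i z).
  exact: vM.
by rewrite lef_pV2 ?posrE ?mulr_gt0// ler_pM2l.
Qed.

(** * Directional derivatives: linear substitution and measurability *)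

Section directional_derivatives.
Context {R : realType}.

(** By linearity the two difference quotients are the same function of the increment, so the limits
    agree whether or not they exist. *)
Lemma derive_comp_linear {d d1 : nat} (L : {linear 'rV[R]_d -> 'rV[R]_d1})
    (G : 'rV[R]_d1 -> R) (x v : 'rV[R]_d) :
  'D_v (G \o L) x = 'D_(L v) G (L x).
Proof. by rewrite /derive /=; under eq_fun do rewrite linearP. Qed.

Lemma partials0 (d : nat) (s : seq 'I_d) : partials s (fun=> 0 : R) = fun=> 0.
Proof.
elim: s => //= i s IH; apply/funext => x.
by rewrite IH; exact: derive_cst.
Qed.

(** The derivative is the pointwise limit of the difference quotients with increments 1/(n+1), each
    measurable in [w]. *)
Lemma measurable_derive (disp : measure_display) (T : measurableType disp)
    (d : nat) (F : T -> 'rV[R]_d -> R) (v x : 'rV[R]_d) :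
  (forall z, measurable_fun setT (F ^~ z)) ->
  (forall w, differentiable (F w) x) ->
  measurable_fun setT (fun w => 'D_v (F w) x).
Proof.
move=> mF dF.
apply: (@measurable_fun_cvg _ _ _ _
  (fun n w => (@harmonic R n)^-1 * (F w (harmonic n *: v + x) - F w x))).
  move=> n; apply: measurable_funM => //.
  exact: (measurable_funB (mF _) (mF _)).
move=> w _.
(* The increments tend to 0 without ever being 0, as the punctured limit defining the derivative
   requires. *)
have h0 : @harmonic R @ \oo --> (0 : R)^'.
  move=> A /cvg_harmonic; rewrite !near_simpl /=.
  by apply: filterS => n; apply; rewrite gt_eqF// harmonic_gt0.
exact: (cvg_comp _ _ h0 (diff_derivable (dF w))).
Qed.
End directional_derivatives.

(** * Bounds on the tensors D^n versus bounds on their entries *)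

Section boundedness.
Context {R : realType}.

(** Each entry is at most the Euclidean norm; conversely, finitely many entry bounds [M i] combine
    into the norm of the vector [M]. *)
Lemma bounded_sqrt_sum {I : finType} {W : Type} (a : I -> W -> R) :
  (exists M, forall w, Num.sqrt (\sum_i a i w ^+ 2) <= M) <->
  (forall i, exists M, forall w, `|a i w| <= M).
Proof.
split=> [[M aM] i|/choice[M aM]].
  exists M => w; apply: le_trans (aM w); rewrite -sqrtr_sqr ler_wsqrtr//.
  by rewrite (bigD1 i)//= lerDl sumr_ge0// => j _; exact: sqr_ge0.
exists (Num.sqrt (\sum_i M i ^+ 2)) => w; apply/ler_wsqrtr/ler_sum => i _.
rewrite -real_normK ?num_real// lerXn2r ?nnegrE//.
exact: le_trans (aM i w).
Qed.

Context {d : nat} {disp : measure_display} {T : measurableType disp}.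
Variable tau : 'rV[R]_d -> T -> T.

Lemma normD_boundedP (f : T -> R) :
  (forall n, exists M, forall w, normD tau n f w <= M) <->
  (forall q, exists M, forall w, `|Dpart tau q f w| <= M).
Proof.
split=> [fM q|fM n].
  pose a (p : (size q).-tuple 'I_d) := Dpart tau p f.
  exact: (iffLR (bounded_sqrt_sum a) (fM (size q)) (in_tuple q)).
pose a (p : n.-tuple 'I_d) := Dpart tau p f.
by apply: (iffRL (bounded_sqrt_sum a)) => p; exact: (fM p).
Qed.

Lemma normDvec_boundedP (phi : T -> 'rV[R]_d) :
  (forall n, exists M, forall w, normDvec tau n phi w <= M) <->
  (forall i q, exists M, forall w, `|Dpart tau q (coordinate phi i) w| <= M).
Proof.
(* Pairing the component with the index tuple turns the double sum into a single finite one. *)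
pose a n (p : 'I_d * n.-tuple 'I_d) := Dpart tau p.2 (coordinate phi p.1).
have aE n w : normDvec tau n phi w = Num.sqrt (\sum_p a n p w ^+ 2).
  by rewrite /normDvec pair_bigA.
split=> [fM i q|fM n].
  apply: (iffLR (bounded_sqrt_sum (a (size q))) _ (i, in_tuple q)).
  by have [M hM] := fM (size q); exists M => w; rewrite -aE.
have [p|M hM] := iffRL (bounded_sqrt_sum (a n)); first exact: fM.
by exists M => w; rewrite aE.
Qed.
End boundedness.

(** * Pullback of test functions and fields along an equivariant factor map *)

Section factor.
Context {R : realType} {d d1 : nat}.
(* L is a coordinate projection: it keeps the coordinate i under the name j when
   sigma i = Some j and forgets i when sigma i = None. The extension takes
   L = lsubmx, the perturbation L = id. *)
Variables (L : {linear 'rV[R]_d -> 'rV[R]_d1})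
  (sigma : 'I_d -> option 'I_d1) (iota : 'I_d1 -> 'I_d).
Hypotheses (L_cont : continuous L)
  (L_basis : forall i, L 'e_i = oapp (fun j => 'e_j) 0 (sigma i))
  (iotaK : pcancel iota sigma)
  (sigmaK : forall i j, sigma i = Some j -> iota j = i).

(** For the extension [pull_row y] is (y, 0); for the perturbation it is [y] itself. *)
Definition pull_row (v : 'rV[R]_d1) : 'rV[R]_d := \row_i oapp (v 0) 0 (sigma i).

(** The result is [None] as soon as one index is forgotten: differentiating [F \o L] in that
    direction gives 0. *)
Definition pull_seq : seq 'I_d -> option (seq 'I_d1) :=
  foldr (fun i o => obind (fun j => omap (cons j) o) (sigma i)) (Some [::]).

(** Forgotten indices contribute [H None = 0], and [iota] is a bijection onto the kept ones. Squared
    norms and divergences are both sums of this kind. *)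
Lemma sum_pull (H : option 'I_d1 -> R) :
  H None = 0 -> \sum_i H (sigma i) = \sum_j H (Some j).
Proof.
move=> H0; rewrite (bigID (fun i => isSome (sigma i)))/=.
rewrite [X in _ + X]big1 ?addr0; last by move=> i; case: (sigma i).
rewrite (reindex_omap iota sigma)/=; last first.
  by move=> i; case E : (sigma i) => [j|]//= _; rewrite (sigmaK E).
by apply: eq_big => [j|j _]; rewrite iotaK//= eqxx.
Qed.

(** Chain rule, one index at a time: differentiating along ['e_i] becomes differentiating along
    [L 'e_i], which is a basis vector or 0. *)
Lemma partials_pull (q : seq 'I_d) (F : 'rV[R]_d1 -> R) :
  partials q (F \o L) =
  oapp (fun q1 => partials q1 F \o L) (fun=> 0) (pull_seq q).
Proof.
elim: q => //= i q IH; apply/funext => x; rewrite IH.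
case: (pull_seq q) => [q1|]/=; last first.
  by case: (sigma i) => [j|] /=; exact: derive_cst.
rewrite derive_comp_linear L_basis.
by case: (sigma i) => [j|]//=; rewrite derive0.
Qed.

Lemma smooth_pull (F : 'rV[R]_d1 -> R) : smooth F -> smooth (F \o L).
Proof.
move=> sF q x; rewrite partials_pull.
case: (pull_seq q) => [q1|]/=; last exact: differentiable_cst.
by apply: differentiable_comp; [exact: linear_differentiable|exact: sF].
Qed.

Lemma sqnorm_pull (v : 'rV[R]_d1) : sqnorm (pull_row v) = sqnorm v.
Proof.
rewrite /sqnorm -(@sum_pull (fun o => oapp (v 0) 0 o ^+ 2)) ?expr0n//.
by apply: eq_bigr => i _; rewrite mxE.
Qed.

Context {disp disp1 : measure_display} {T : measurableType disp}
  {T1 : measurableType disp1}.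
Variables (P : probability T R) (P1 : probability T1 R)
  (tau : 'rV[R]_d -> T -> T) (tau1 : 'rV[R]_d1 -> T1 -> T1) (pi : T -> T1).
Hypotheses (tau1_0 : forall z, tau1 0 z = z)
  (tau1_meas : forall x, measurable_fun setT (tau1 x))
  (pi_meas : measurable_fun setT pi)
  (pi_tau : forall x w, pi (tau x w) = tau1 (L x) (pi w))
  (pi_marginal : forall A, measurable A -> P (pi @^-1` A) = P1 A).

Lemma realization_pull (f : T1 -> R) (w : T) :
  realization tau (f \o pi) w = realization tau1 f (pi w) \o L.
Proof. by apply/funext => x; rewrite /realization /= pi_tau. Qed.

Lemma Dpart_pull (q : seq 'I_d) (f : T1 -> R) (w : T) :
  Dpart tau q (f \o pi) w =
  oapp (fun q1 => Dpart tau1 q1 f (pi w)) 0 (pull_seq q).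
Proof.
rewrite /Dpart realization_pull partials_pull.
by case: (pull_seq q) => //= q1; rewrite linear0.
Qed.

Lemma Dpart_pull_bounded (f : T1 -> R) :
  (forall q, exists M, forall z, `|Dpart tau1 q f z| <= M) ->
  forall q, exists M, forall w, `|Dpart tau q (f \o pi) w| <= M.
Proof.
move=> fM q; case E : (pull_seq q) => [q1|]; last first.
  by exists 0 => w; rewrite Dpart_pull E normr0.
by have [M hM] := fM q1; exists M => w; rewrite Dpart_pull E; exact: hM.
Qed.

Lemma grad_pull (f : T1 -> R) (w : T) :
  grad tau (f \o pi) w = pull_row (grad tau1 f (pi w)).
Proof.
apply/rowP => i; rewrite !mxE Dpart_pull /=.
by case: (sigma i) => //= j; rewrite mxE.
Qed.

Lemma coordinate_pull (phi : T1 -> 'rV[R]_d1) (i : 'I_d) :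
  coordinate (pull_row \o phi \o pi) i =
  oapp (fun j => coordinate phi j \o pi) (fun=> 0) (sigma i).
Proof.
apply/funext => w; rewrite /coordinate /= mxE.
by case: (sigma i).
Qed.

Lemma realization0 (w : T) : realization tau (fun=> 0 : R) w = fun=> 0.
Proof. by []. Qed.

Lemma Dpart0 (q : seq 'I_d) (w : T) : Dpart tau q (fun=> 0 : R) w = 0.
Proof. by rewrite /Dpart realization0 partials0. Qed.

Lemma class_F_pull (f : T1 -> R) :
  class_F P1 tau1 f -> class_F P tau (f \o pi).
Proof.
move=> [fi fE [c [c0 cf]] fs /normD_boundedP fM].
have mf : measurable_fun setT f by apply/measurable_EFinP; exact: measurable_int fi.
have fpi := integrable_marginal pi_meas pi_marginal fi.
split => //.
- by move: fE; rewrite unlock (integral_marginal pi_meas pi_marginal).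
- by exists c; split => // w; exact: cf.
- by move=> w; rewrite realization_pull; exact: smooth_pull.
- exact/normD_boundedP/Dpart_pull_bounded.
Qed.

Lemma class_Phi_pull (y : 'rV[R]_d1) (phi : T1 -> 'rV[R]_d1) :
  class_Phi P1 tau1 y phi ->
  class_Phi P tau (pull_row y) (pull_row \o phi \o pi).
Proof.
move=> [phii phis /normDvec_boundedP phiM phiE phi0]; split.
- move=> i; rewrite coordinate_pull; case: (sigma i) => [j|]/=.
    exact: (integrable_marginal pi_meas pi_marginal (phii j)).
  exact: finite_measure_integrable_cst.
- move=> i w; rewrite coordinate_pull; case: (sigma i) => [j|]/=.
    by rewrite realization_pull; exact: smooth_pull.
  by rewrite realization0 => q x; rewrite partials0.
- apply/normDvec_boundedP => i q; rewrite coordinate_pull.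
  case: (sigma i) => [j|]/=; first exact: Dpart_pull_bounded.
  by exists 0 => w; rewrite Dpart0 normr0.
- move=> i; rewrite coordinate_pull mxE; case: (sigma i) => [j|]/=.
    rewrite -phiE unlock (integral_marginal pi_meas pi_marginal)//.
      by apply/measurable_EFinP; exact: measurable_int (phii j).
    exact: (integrable_marginal pi_meas pi_marginal (phii j)).
  by rewrite unlock integral0.
- move=> w; rewrite -(phi0 (pi w)) /divergence.
  (* For a kept index the component and the direction are renamed to the same [j]; for a forgotten
     one the padded component is identically 0. *)
  rewrite -(@sum_pull (fun o => oapp
    (fun j => Dpart tau1 [:: j] (coordinate phi j) (pi w)) 0 o))//.
  apply: eq_bigr => i _; rewrite coordinate_pull.
  by case E : (sigma i) => [j|]/=; rewrite ?Dpart0// Dpart_pull/= E.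
Qed.

Lemma measurable_grad (f : T1 -> R) i :
  measurable_fun setT f -> (forall z, smooth (realization tau1 f z)) ->
  measurable_fun setT (coordinate (grad tau1 f) i).
Proof.
move=> mf fs.
have -> : coordinate (grad tau1 f) i =
    fun z => 'D_('e_i) (realization tau1 f z) 0.
  by apply/funext => z; rewrite /coordinate mxE.
apply: measurable_derive => [x|z]; last exact: (fs z [::] 0).
exact: measurableT_comp.
Qed.

(** Every [f] for the factor yields the competitor [f \o pi], with the same energy and an inner
    infimum that is no larger. *)
Lemma Gamma_pull (V : T -> R) (g : T1 -> R) (y : 'rV[R]_d1) :
  potential P V -> measurable_fun setT g ->
  P.-integrable setT (EFin \o (g \o pi)) ->
  (forall A, measurable A ->
    (\int[P]_(w in pi @^-1` A) (g (pi w))%:E =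
     \int[P]_(w in pi @^-1` A) (V w)%:E)%E) ->
  (Gamma P tau V (pull_row y) <= Gamma P1 tau1 g y)%E.
Proof.
move=> [V0 iV] mg ig gV; rewrite /Gamma lee_pmul2l//.
apply: le_ereal_inf_tmp => _ [f Ff <-].
have Ff' := class_F_pull Ff.
have [fi _ [c [c0 cf]] fs /normD_boundedP fM] := Ff.
have mf : measurable_fun setT f by apply/measurable_EFinP; exact: measurable_int fi.
have f0 z : 0 <= f z by exact: le_trans (ltW c0) (cf z).
(* The empty index list is the case n = 0, a bound on [f] itself. *)
have [M fbd] := fM [::].
have {}fbd z : `|f z| <= M.
  by have := fbd z; rewrite /Dpart /= /realization tau1_0.
pose A z := sqnorm (grad tau1 f z) / (8 * f z).
have mA i : measurable_fun setT (coordinate (grad tau1 f) i).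
  exact: measurable_grad.
have iA : P1.-integrable setT (EFin \o A).
  apply: (@integrable_sqnorm_div _ _ _ _ _ _ _ _ c) => // i.
  by have [N fN] := fM [:: i]; exists N => z; rewrite /coordinate mxE.
have iApi := integrable_marginal pi_meas pi_marginal iA.
have mfpi : measurable_fun setT (f \o pi) by exact: measurableT_comp.
have mAf : measurable_fun setT A by apply/measurable_EFinP; exact: measurable_int iA.
have iVf := integrable_bounded_mul iV mfpi (fun w => fbd (pi w)).
have igf := integrable_bounded_mul ig mfpi (fun w => fbd (pi w)).
(* Only the potential term needs conditioning: it is split off, [V] is exchanged for [g \o pi]
   against the bounded [f \o pi], and the recombined integrand is a function of [pi], hence
   transferable to [P1]. *)
have energy : (\int[P]_w (sqnorm (grad tau (f \o pi) w) / (8 * (f \o pi) w) +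
    V w * (f \o pi) w)%:E =
    \int[P1]_z (sqnorm (grad tau1 f z) / (8 * f z) + g z * f z)%:E)%E.
  under eq_integral do rewrite grad_pull sqnorm_pull EFinD.
  rewrite integralD//.
  rewrite -(integral_mul_preim pi_meas ig iV gV mf (M := M)); last first.
    by move=> z; rewrite f0; exact: le_trans (ler_norm _) (fbd z).
  rewrite -integralD//.
  rewrite -(integral_marginal (f := fun z => A z + g z * f z) pi_meas pi_marginal)//.
    by apply: measurable_funD => //; exact: measurable_funM.
  exact: (integrableD measurableT iApi igf).
(* Padding by zeros embeds the admissible fields of the factor among those of the large system at
   equal cost. *)
have le_inf : (ereal_inf [set \int[P]_w (sqnorm (phi w) / (2 * (f \o pi) w))%:E
      | phi in class_Phi P tau (pull_row y)] <=
    ereal_inf [set \int[P1]_w (sqnorm (phi w) / (2 * f w))%:E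
      | phi in class_Phi P1 tau1 y])%E.
  apply: le_ereal_inf_tmp => _ [phi phiy <-]; apply: ereal_inf_lbound.
  exists (pull_row \o phi \o pi); first exact: class_Phi_pull.
  under eq_integral do rewrite /= sqnorm_pull.
  have [phii phis /normDvec_boundedP phiM _ _] := phiy.
  have iphi : P1.-integrable setT (fun z => (sqnorm (phi z) / (2 * f z))%:E).
    apply: (@integrable_sqnorm_div _ _ _ _ _ _ _ _ c) => // i.
      by apply/measurable_EFinP; exact: measurable_int (phii i).
    have [N phiN] := phiM i [::]; exists N => z.
    by have := phiN z; rewrite /Dpart /= /realization tau1_0.
  rewrite (integral_marginal (f := fun z => sqnorm (phi z) / (2 * f z)) pi_meas pi_marginal)//.
    by apply/measurable_EFinP; exact: measurable_int iphi.
  exact: (integrable_marginal (f := fun z => sqnorm (phi z) / (2 * f z)) pi_meas pi_marginal iphi).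
apply: (@le_trans _ _ (sqrte ((\int[P]_w (sqnorm (grad tau (f \o pi) w) /
    (8 * (f \o pi) w) + V w * (f \o pi) w)%:E) *
  ereal_inf [set \int[P]_w (sqnorm (phi w) / (2 * (f \o pi) w))%:E
      | phi in class_Phi P tau (pull_row y)])%E)).
  by apply: ereal_inf_lbound; exists (f \o pi).
(* The sign is read off on the side of [P], where [V] is nonnegative pointwise; [g] carries no such
   pointwise sign. *)
have energy_ge0 : (0 <= \int[P]_w (sqnorm (grad tau (f \o pi) w) / (8 * (f \o pi) w) +
    V w * (f \o pi) w)%:E)%E.
  apply: integral_ge0 => w _; rewrite lee_fin; apply: addr_ge0.
    exact: (divr_ge0 (sqnorm_ge0 _) (mulr_ge0 _ (f0 _))).
  exact: mulr_ge0 (V0 w) (f0 _).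
rewrite -energy lee_sqrt//; last first.
  apply: mule_ge0 => //; apply: le_ereal_inf_tmp => _ [phi _ <-].
  apply: integral_ge0 => w _; rewrite lee_fin.
  exact: (divr_ge0 (sqnorm_ge0 _) (mulr_ge0 _ (f0 _))).
by rewrite lee_wpmul2l.
Qed.
End factor.

(** * The extension and the perturbation as instances of the factor setting *)

Theorem theorem3p4 (R : realType) (d1 d2 : nat)
  (disp1 disp2 : measure_display)
  (T1 : measurableType disp1) (T2 : measurableType disp2)
  (P1 : probability T1 R) (P2 : probability T2 R)
  (tau1 : 'rV[R]_d1 -> T1 -> T1) (tau2 : 'rV[R]_d2 -> T2 -> T2)
  (mds1 : metric_dynamical_system P1 tau1)
  (mds2 : metric_dynamical_system P2 tau2) :
  (forall (P : probability (T1 * T2)%type R) (V : T1 * T2 -> R)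
     (g : T1 -> R) (y : 'rV[R]_d1),
     joining P1 P2 (extension tau1 tau2) P ->
     potential P V ->
     is_condexp_fst P V g ->
     (Gamma P (extension tau1 tau2) V (row_mx y (0 : 'rV[R]_d2))
        <= Gamma P1 tau1 g y)%E)
  /\
  (forall (eqd : d1 = d2) (P : probability (T1 * T2)%type R)
     (V : T1 * T2 -> R) (g : T1 -> R) (y : 'rV[R]_d1),
     joining P1 P2 (perturbation eqd tau1 tau2) P ->
     potential P V ->
     is_condexp_fst P V g ->
     (Gamma P (perturbation eqd tau1 tau2) V y
        <= Gamma P1 tau1 g y)%E).
Proof.
have [_ tau1_0 _ tau1_meas _] := mds1.
have tau1_meas_at x : measurable_fun setT (tau1 x).
  exact: (measurableT_comp tau1_meas (pair1_measurable (x : borel_rV R d1))).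
split=> [P V g y [P_fst _ _] potV [mg ig gV]|eqd P V g y [P_fst _ _] potV [mg ig gV]].
(* The first [d1] coordinates are kept and the last [d2] forgotten, so padding by zeros gives
   [row_mx y 0]. *)
- pose sigma (i : 'I_(d1 + d2)) := if fintype.split i is inl j then Some j else None.
  have -> : row_mx y 0 = pull_row sigma y.
    apply/rowP => i; rewrite !mxE /sigma; case: (fintype.split i) => //= j.
    by rewrite mxE.
  apply: (@Gamma_pull _ _ _ (@lsubmx R 1 d1 d2) sigma (lshift d2)
    _ _ _ _ _ _ _ _ _ P1 _ tau1 fst) => //.
  + exact: continuous_lsubmx.
  + move=> i; apply/rowP => j; rewrite /sigma !mxE.
    case: (split_ordP i) => k ->; rewrite ?(unsplitK (inl k)) ?(unsplitK (inr k)) /= mxE.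
      by rewrite eq_lshift.
    by rewrite eq_lrshift.
  + by move=> j; rewrite /sigma (unsplitK (inl j)).
  + move=> i j; rewrite /sigma.
    case: (split_ordP i) => k ->;
      rewrite ?(unsplitK (inl k)) ?(unsplitK (inr k))//.
    by case=> <-.
(* Here no coordinate is forgotten: the first component already moves under [tau1] with the full
   parameter. *)
- rewrite {1}(_ : y = pull_row Some y); last by apply/rowP => i; rewrite mxE.
  apply: (@Gamma_pull _ _ _ (idfun : {linear 'rV[R]_d1 -> 'rV[R]_d1}) Some id
    _ _ _ _ _ _ _ _ _ P1 _ tau1 fst) => //.
  + by move=> x.
  + by move=> i j [].
Qed.
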